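(* Let $G$ be a countable discrete and amenable group and let $m\in\mathbb{N}$, $m\geq1$, be arbitrary. Let $\chi:G^m\to\{1,\ldots,r\}$ be any given finite coloring. 1. If $G$ is a right van der Waerden group, then $D_m(\chi)$ is left IP$^{\ast}$. 2. If $G$ is a left van der Waerden group, then $S_m(\chi)$ is right IP$^{\ast}$.
   Context: Corner sets. $\mathcal{R}^{(j)}_g$ and $\mathcal{L}^{(j)}_g$ denote right, respectively left, multiplication by $g\in G$ on the $j$-th component of $G^m$. For a coloring $\chi:G^m\to\{1,\ldots,r\}$ put $C_j=\chi^{-1}(j)$. Then $D_m(\chi)$ is the set of $g\in G$ for which there exist $1\leq j\leq r$ and $x\in G^m$ with $\{x,\mathcal{R}_g^{(1)}x,\mathcal{R}_g^{(1)}\mathcal{R}_g^{(2)}x,\ldots,\mathcal{R}_g^{(1)}\cdots\mathcal{R}_g^{(m)}x\}\subseteq C_j$, and $S_m(\chi)$ is defined in the same way with each $\mathcal{R}$ replaced by $\mathcal{L}$. IP sets. For a sequence $(x_n)_{n\in\mathbb{N}}$ in $G$, let $\mathbf{FP}_L(x_n)=\{x_{n_k}x_{n_{k-1}}\cdots x_{n_1}: k\geq 1,\ n_1<\dots<n_k\}$ and $\mathbf{FP}_R(x_n)=\{x_{n_1}x_{n_2}\cdots x_{n_k}: k\geq 1,\ n_1<\dots<n_k\}$. A subset of $G$ is a left (resp. right) IP set if it contains $\mathbf{FP}_L(x_n)$ (resp. $\mathbf{FP}_R(x_n)$) for some sequence $(x_n)$. A subset of $G$ is left (resp. right) IP$^{\ast}$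 if it meets every left (resp. right) IP set. Largeness in a group $H$. $S\subseteq H$ is right syndetic if $H=\bigcup_{h\in F}h^{-1}S$ for some finite $F\subseteq H$, and left syndetic if $H=\bigcup_{h\in F}Sh^{-1}$ for some finite $F\subseteq H$. $T\subseteq H$ is right thick if for every finite $F\subseteq H$ there is $x\in H$ with $Fx\subseteq T$, and left thick if for every finite $F\subseteq H$ there is $x\in H$ with $xF\subseteq T$. Van der Waerden property. A nonempty family $\mathcal{W}$ of subsets of $H$ with $\emptyset\notin\mathcal{W}$ has the almost right van der Waerden property if for each $A\in\mathcal{W}$ at least one of the following holds: (i) there is a right syndetic $S\subseteq H$ with $\bigcap_{f\in F}Af^{-1}\in\mathcal{W}$ for all finite nonempty $F\subseteq S$; (ii) there is a left thick $T\subseteq H$ with $\bigcap_{f\in F}Af^{-1}\in\mathcal{W}$ for all finite nonempty $F\subseteq T$. It has the right van der Waerden property if in addition it is partition regular (whenever $A\in\mathcal{W}$ is a finite union $A=A_1\cup\dots\cup A_n$, some $A_i\in\mathcal{W}$) and closed under right translation ($A\in\mathcal{W}$, $x\in H$ imply $Ax\in\mathcal{W}$). The left van der Waerden property is the mirror image: ''right syndetic'' is replaced by ''left syndetic'', ''left thick'' by ''right thick'', $Af^{-1}$ by $f^{-1}A$, and right translation by left translation. A countable, discrete, amenable group $G$ is a right (resp. left) van der Waerden group if for every $m\in\mathbb{N}$ the group $G^m$ possesses a family of subsets with the right (resp. left) van der Waerden property. *)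

(* Defs.v *)
From HB Require Import structures.
From mathcomp Require Import all_boot all_order all_algebra.
From mathcomp Require Import all_classical reals.

Set Implicit Arguments.
Unset Strict Implicit.
Unset Printing Implicit Defensive.

Local Open Scope classical_set_scope.
Local Open Scope group_scope.

Section GroupSubsets.
Context {H : groupType}.
Implicit Types (A S T F : set H) (x f h : H) (W : set (set H)).

Definition ltranslate x A : set H := [set x * a | a in A].
Definition rtranslate A x : set H := [set a * x | a in A].

Definition right_syndetic S : Prop :=
  exists F, finite_set F /\ [set: H] = \bigcup_(h in F) ltranslate h^-1 S.

Definition left_syndetic S : Prop :=
  exists F, finite_set F /\ [set: H] = \bigcup_(h in F) rtranslate S h^-1.

Definition right_thick T : Prop :=
  forall F, finite_set F -> exists x, rtranslate F x `<=` T.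

Definition left_thick T : Prop :=
  forall F, finite_set F -> exists x, ltranslate x F `<=` T.

Definition right_returns W A S : Prop :=
  forall F, finite_set F -> F !=set0 -> F `<=` S ->
    W (\bigcap_(f in F) rtranslate A f^-1).

Definition left_returns W A S : Prop :=
  forall F, finite_set F -> F !=set0 -> F `<=` S ->
    W (\bigcap_(f in F) ltranslate f^-1 A).

Definition almost_right_vdW W : Prop :=
  [/\ W !=set0, ~ W set0 &
      forall A, W A ->
        (exists S, right_syndetic S /\ right_returns W A S) \/
        (exists T, left_thick T /\ right_returns W A T)].

Definition almost_left_vdW W : Prop :=
  [/\ W !=set0, ~ W set0 &
      forall A, W A ->
        (exists S, left_syndetic S /\ left_returns W A S) \/
        (exists T, right_thick T /\ left_returns W A T)].

Definition partition_regular W : Prop :=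
  forall A, W A -> forall (n : nat) (B : 'I_n -> set H),
    A = \bigcup_i B i -> exists i, W (B i).

Definition right_vdW W : Prop :=
  [/\ almost_right_vdW W, partition_regular W &
      forall A x, W A -> W (rtranslate A x)].

Definition left_vdW W : Prop :=
  [/\ almost_left_vdW W, partition_regular W &
      forall A x, W A -> W (ltranslate x A)].

End GroupSubsets.

(* A finitely additive, left-invariant probability measure on all subsets;
   left, right and two-sided invariance give the same class of groups. *)
Definition amenable (R : realType) (G : groupType) : Prop :=
  exists mu : set G -> R,
    [/\ forall A, (0 <= mu A)%R,
        mu [set: G] = 1%R,
        forall A B, A `&` B = set0 -> mu (A `|` B) = (mu A + mu B)%R &
        forall g A, mu (ltranslate g A) = mu A].

(* Countability and amenability of G are not repeated here. G^m is the
   pointwise group {ffun 'I_m -> G}, with components numbered from 0. *)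
Definition right_vdW_group (G : groupType) : Prop :=
  forall m : nat, (0 < m)%N ->
    exists W : set (set {ffun 'I_m -> G}), right_vdW W.

Definition left_vdW_group (G : groupType) : Prop :=
  forall m : nat, (0 < m)%N ->
    exists W : set (set {ffun 'I_m -> G}), left_vdW W.

Section IPSets.
Context {G : groupType}.
Implicit Types (x : nat -> G) (A : set G).

(* s lists the indices n_1 < ... < n_k. *)
Definition FP_L x : set G :=
  [set g | exists s : seq nat,
     [/\ s != [::], sorted ltn s & g = \prod_(n <- rev s) x n]].

Definition FP_R x : set G :=
  [set g | exists s : seq nat,
     [/\ s != [::], sorted ltn s & g = \prod_(n <- s) x n]].

Definition left_IP A : Prop := exists x, FP_L x `<=` A.
Definition right_IP A : Prop := exists x, FP_R x `<=` A.

Definition left_IPstar A : Prop := forall B, left_IP B -> A `&` B !=set0.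
Definition right_IPstar A : Prop := forall B, right_IP B -> A `&` B !=set0.

End IPSets.

Section Corners.
Context {G : groupType} {m : nat}.
Implicit Types (g : G) (j : 'I_m) (x : {ffun 'I_m -> G}).

Definition Rmul g j x : {ffun 'I_m -> G} :=
  [ffun i => if i == j then x i * g else x i].

Definition Lmul g j x : {ffun 'I_m -> G} :=
  [ffun i => if i == j then g * x i else x i].

(* The k-th point is the composite of the operators on the first k components,
   applied to x. *)
Definition right_corner g x : set {ffun 'I_m -> G} :=
  [set foldr (Rmul g) x (take k (enum 'I_m)) | k in `I_m.+1].

Definition left_corner g x : set {ffun 'I_m -> G} :=
  [set foldr (Lmul g) x (take k (enum 'I_m)) | k in `I_m.+1].

Definition right_corner_set r (chi : {ffun 'I_m -> G} -> 'I_r) : set G :=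
  [set g | exists (j : 'I_r) x, right_corner g x `<=` chi @^-1` [set j]].

Definition left_corner_set r (chi : {ffun 'I_m -> G} -> 'I_r) : set G :=
  [set g | exists (j : 'I_r) x, left_corner g x `<=` chi @^-1` [set j]].

End Corners.

(* Main.v *)
(** For g in G let B_{a,b}(g) in G^m be g on the components a, ..., b-1 and 1
elsewhere; a corner is y, y B_{a,a+1}(g), ..., y B_{a,a+k}(g). Two statements
are proved together by induction on k, for g ranging over the products
x_{n_l} ... x_{n_1} with all indices above a given bound:
- recurrence: for A in W, the apexes of corners contained in A form a member
  of W;
- colouring: every finite colouring of G^m has a monochromatic corner.
Recurrence at (a+1, k) gives colouring at (a, k+1) by colour focusing: a corner
on the components from a+1 on, moved back by B_{a,a+1}(g), becomes a corner on
the components from a on, without its apex. Colouring gives recurrence because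
right syndeticity of the set S of returns of A means that every y satisfies
h y in S for some h in a finite set: colouring y by h, a monochromatic corner E
has hE contained in S for a single h. The left statement is the image of the
right one under inversion. *)

Require Import Defs.
From mathcomp Require Import all_boot all_order all_algebra.
From mathcomp Require Import all_classical reals.

Local Open Scope classical_set_scope.

(** * Consequences of the right van der Waerden property *)

Section RightVdW.
Local Open Scope group_scope.
Context {H : groupType} {W : set (set H)}.
Implicit Types (A S : set H).

Lemma rtranslateE (A : set H) x : rtranslate A x = [set y | A (y * x^-1)].
Proof.
apply/seteqP; split=> [_ [a Aa <-]|y Ay] /=; first by rewrite mulgK.
by exists (y * x^-1); rewrite // mulgVK.
Qed.

Lemma ltranslateE (A : set H) x : ltranslate x A = [set y | A (x^-1 * y)].
Proof.
apply/seteqP; split=> [_ [a Aa <-]|y Ay] /=; first by rewrite mulKg.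
by exists (x^-1 * y); rewrite // mulVKg.
Qed.

Hypothesis vdW : right_vdW W.

Lemma right_vdW_shift A x : W A -> W [set y | A (y * x)].
Proof.
by case: vdW => _ _ trW /(trW A x^-1); rewrite rtranslateE invgK.
Qed.

Lemma right_vdW_color A r (c : H -> 'I_r) :
  W A -> exists i, W [set y | A y /\ c y = i].
Proof.
case: vdW => _ reg _ WA.
apply: (reg A WA r (fun i => [set y | A y /\ c y = i])).
by apply/seteqP; split=> [y Ay|y [i _ []]] //; exists (c y).
Qed.

(* In the thick alternative, translating back by y shows that A returns along
   every finite set, so that S can be taken to be H. *)
Lemma right_vdW_syndetic A : W A ->
  exists S, right_syndetic S /\ right_returns W A S.
Proof.
move=> WA; case: vdW => -[_ _ /(_ A WA)[//|[T [thT retT]]]] _ _.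
exists setT; split=> [|F finF [f0 Ff0] _].
  exists [set 1]; split; first exact: finite_set1.
  by rewrite bigcup_set1 ltranslateE.
have [y yFT] := thT F finF.
have /(right_vdW_shift _ y^-1) :
    W (\bigcap_(f in ltranslate y F) rtranslate A f^-1).
  apply: retT => //; first exact: finite_image.
  by exists (y * f0), f0.
congr W; rewrite bigcap_image; apply/seteqP.
by split=> z zF f /zF; rewrite !rtranslateE /= !invgK mulgA mulgVK.
Qed.

Lemma right_vdW_returns A : W A ->
  exists n (c : H -> 'I_n), forall E : set H,
    finite_set E -> E !=set0 ->
    (exists i, forall e, E e -> c e = i) ->
    exists h, W [set z | forall e, E e -> A (z * (h * e))].
Proof.
move=> WA; have [S [[F [finF synS]] retS]] := right_vdW_syndetic A WA.
have /finite_seqP[s Fs] := finF.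
have hF (y : H) : exists h, h \in s /\ S (h * y).
  have : [set: H] y by [].
  rewrite synS => -[h Fh]; rewrite ltranslateE /= invgK => Shy.
  by exists h; split=> //; move: Fh; rewrite Fs.
have [h hP] := choice hF.
have hs y : (index (h y) s < size s)%N by rewrite index_mem; case: (hP y).
exists (size s), (fun y => Ordinal (hs y)) => E finE [e0 Ee0] [i iE].
have hE e : E e -> h e = h e0.
  move=> Ee; have /(congr1 val) /= : Ordinal (hs e) = Ordinal (hs e0).
    by rewrite !iE.
  (* The default [1] of [nth] is never reached: every [h e] lies in [s]. *)
  move/(congr1 (nth 1 s)).
  by rewrite !nth_index //; [case: (hP e0)|case: (hP e)].
exists (h e0).
have : W (\bigcap_(f in ltranslate (h e0) E) rtranslate A f^-1).
  apply: retS; first exact: finite_image.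
    by exists (h e0 * e0), e0.
  by move=> _ [e Ee <-]; rewrite -(hE e Ee); case: (hP e).
congr W; rewrite bigcap_image; apply/seteqP.
by split=> z zF f /zF; rewrite rtranslateE /= invgK.
Qed.

End RightVdW.

(** * Corners written with blocks *)

Section Blocks.
Local Open Scope group_scope.
Context {G : groupType} {m : nat}.
Implicit Types (g : G) (x : {ffun 'I_m -> G}) (a b : nat).

Definition block a b g : {ffun 'I_m -> G} :=
  [ffun i : 'I_m => if (a <= i < b)%N then g else 1].

Lemma blockM a b g g' : block a b (g * g') = block a b g * block a b g'.
Proof. by apply/ffunP => i; rewrite !ffunE; case: ifP; rewrite ?mulg1. Qed.

Lemma block_cat a b d g : (a <= b)%N -> (b <= d)%N ->
  block a d g = block a b g * block b d g.
Proof.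
move=> ab bd; apply/ffunP => i; rewrite !ffunE.
case: (ltnP i b) => [ib|bi]; first by rewrite (leq_trans ib bd) andbT mulg1.
by rewrite (leq_trans ab bi) andbF mul1g.
Qed.

Lemma block_id a g : block a a g = 1.
Proof. by apply/ffunP => i; rewrite !ffunE; case: ltngtP. Qed.

Lemma foldr_RmulE g x (s : seq 'I_m) : uniq s ->
  foldr (Rmul g) x s = x * [ffun i => if i \in s then g else 1].
Proof.
elim: s => [|j s IHs] /= => [_|/andP[js us]].
  by apply/ffunP => i; rewrite !ffunE mulg1.
rewrite IHs //; apply/ffunP => i; rewrite !ffunE in_cons.
by case: eqP => // ->; rewrite (negPf js) mulg1.
Qed.

Lemma right_cornerE g x :
  right_corner g x = [set x * block 0 k g | k in `I_m.+1].
Proof.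
apply: eq_imagel => k _; rewrite foldr_RmulE ?take_uniq ?enum_uniq //.
congr (_ * _); apply/ffunP => i.
by rewrite !ffunE in_take ?mem_enum // index_enum_ord.
Qed.

(** Componentwise, [g * x i] is the inverse of [(x i)^-1 * g^-1]. *)
Lemma foldr_LmulE g x (s : seq 'I_m) :
  foldr (Lmul g) x s = (foldr (Rmul g^-1) x^-1 s)^-1.
Proof.
elim: s => [|j s IHs] /=; first by rewrite invgK.
apply/ffunP => i; rewrite IHs !ffunE.
by case: eqP => // _; rewrite invgM invgK.
Qed.

Lemma left_cornerE g x :
  left_corner g x = [set y^-1 | y in right_corner g^-1 x^-1].
Proof. by rewrite image_comp; apply: eq_imagel => k _; exact: foldr_LmulE. Qed.

End Blocks.

(** * Colour focusing along products of [x] *)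

Section Focusing.
Local Open Scope group_scope.
Context {G : groupType} {m : nat} {W : set (set {ffun 'I_m -> G})}.
Hypothesis vdW : right_vdW W.
Variable x : nat -> G.

(** Larger indices stand on the left, as in [FP_L]; hence [P (s ++ t) = P t * P s]. *)
Let P (s : seq nat) : G := \prod_(n <- rev s) x n.

Definition segment (N : nat) (s : seq nat) : Prop :=
  [/\ s != [::], sorted ltn s & all (leq N) s].

Lemma segment_cat N M s t :
  (N <= M)%N -> segment N s -> all (gtn M) s -> segment M t ->
  segment N (s ++ t).
Proof.
move=> NM [s0 sort_s Ns] sM [_ sort_t Mt]; split.
- by case: s s0 {sort_s Ns sM}.
- move: sort_s sort_t; rewrite !(sorted_pairwise ltn_trans) pairwise_cat => -> ->.
  rewrite !andbT; apply/allrelP => i j /(allP sM) /= iM /(allP Mt) /= Mj.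
  exact: leq_trans iM Mj.
- by rewrite all_cat Ns; apply: sub_all Mt => i; exact: leq_trans.
Qed.

Definition block_recurrent a k : Prop :=
  forall A N, W A -> exists s, segment N s /\
    W [set z | forall j, (j <= k)%N -> A (z * block a (a + j) (P s))].

Definition block_monochromatic a k : Prop :=
  forall r (c : {ffun 'I_m -> G} -> 'I_r) N, exists s, segment N s /\
    exists i y, forall j, (j <= k)%N -> c (y * block a (a + j) (P s)) = i.

Lemma block_recurrent0 a : block_recurrent a 0.
Proof.
move=> A N WA; exists [:: N]; split; first by split; rewrite //= leqnn.
suff -> : [set z | forall j, (j <= 0)%N ->
    A (z * block a (a + j) (P [:: N]))] = A by [].
apply/seteqP; split=> z => [/(_ 0%N isT)|Az j].
  by rewrite addn0 block_id mulg1.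
by rewrite leqn0 => /eqP ->; rewrite addn0 block_id mulg1.
Qed.

(* Colour focusing: D collects distinct colours d such that every z in A sees
   a corner of colour d whose apex z itself may have another colour. If A lies
   in a colour outside D, then recurrence adds that colour to D. *)
Lemma block_recurrent_monochromatic a k :
  block_recurrent a.+1 k -> block_monochromatic a k.+1.
Proof.
move=> rec r c N.
(* [M] exceeds all indices used so far, so that later segments can be appended; [0 < j] leaves out
   the apex. *)
pose focused A M (D : {set 'I_r}) := [/\ W A, (N <= M)%N & forall d, d \in D ->
  exists s, [/\ segment N s, all (gtn M) s & forall z j, A z ->
    (0 < j <= k.+1)%N -> c (z * block a (a + j) (P s)) = d]].
pose goal := exists s, segment N s /\ exists i y, forall j,
  (j <= k.+1)%N -> c (y * block a (a + j) (P s)) = i.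
(* Only [r] colours exist, so [n = r.+1] forces [goal]. *)
suff step n : goal \/ exists A M D, focused A M D /\ #|D| = n.
  have [//|[A [M [D [_ cardD]]]]] := step r.+1.
  by have := max_card (mem D); rewrite cardD card_ord ltnn.
elim: n => [|n IHn].
  right; case: (vdW) => -[[A WA] _ _] _ _; exists A, N, finset.set0.
  by split; [split=> // d; rewrite inE|exact: cards0].
case: IHn => [|[A [M [D [[WA NM focD] cardD]]]]]; first by left.
have [i WAi] := right_vdW_color vdW A r c WA.
(* If [i] is already in [D], an apex in [A] of colour [i] completes the corner. *)
case: (boolP (i \in D)) => [/focD[s [segs _ sD]]|iD].
  left; exists s; split=> //; exists i.
  have [z [Az cz]] : [set y | A y /\ c y = i] !=set0.
    case: (vdW) => -[_ W0 _] _ _; apply/set0P/eqP => A0.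
    by apply: W0; rewrite -A0.
  exists z => -[_|j jk]; last exact: sD.
  by rewrite addn0 block_id mulg1.
right; have [t [segt WB]] := rec _ M WAi.
set g := P t in WB; set B := [set z | _] in WB.
have Bcorner z j : B (z * block a a.+1 g) -> (0 < j <= k.+1)%N ->
    A (z * block a (a + j) g) /\ c (z * block a (a + j) g) = i.
  case: j => // j Bz /= jk; rewrite (@block_cat _ _ a a.+1) ?leq_addr //.
    by rewrite mulgA -addSnnS; apply: Bz.
  by rewrite -addSnnS leq_addr.
exists [set z | B (z * block a a.+1 g)], (maxn M (\max_(j <- t) j).+1).
exists (i |: D)%SET.
have tM : all (gtn (maxn M (\max_(j <- t) j).+1)) t.
  apply/allP => j jt /=; rewrite leq_max orbC ltnS.
  by rewrite leq_bigmax_seq.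
split; last by rewrite cardsU1 iD cardD.
split; first exact: right_vdW_shift.
  by rewrite leq_max NM.
move=> d; rewrite in_setU1 => /predU1P[->|/focD[s [segs sM sD]]].
  exists t; split=> //.
    case: segt => t0 st Mt; split=> //.
    by apply: sub_all Mt => j; exact: leq_trans.
  by move=> z j /Bcorner /[apply] -[].
(* For an old colour, [block a (a + j) (P t)] moves [z] into [A], and the block of [P s] with the
   same [j] then leads to colour [d]. *)
exists (s ++ t); split.
- exact: segment_cat segt.
- rewrite all_cat tM andbT; apply: sub_all sM => j /= jM.
  by rewrite leq_max jM.
- move=> z j /Bcorner Bj /[dup] jk /Bj[Az _].
  by rewrite /P rev_cat big_cat blockM mulgA sD.
Qed.

Lemma block_monochromatic_recurrent a k :
  block_monochromatic a k -> block_recurrent a k.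
Proof.
move=> mono A N WA; have [n [c ret]] := right_vdW_returns vdW A WA.
have [s [segs [i [y cy]]]] := mono n c N; exists s; split=> //.
have [||| h] := ret [set y * block a (a + j) (P s) | j in `I_k.+1].
- exact/finite_image/finite_II.
- by exists (y * block a (a + 0) (P s)), 0%N.
- by exists i => _ [j jk <-]; exact: cy.
(* Shifting by [(h * y)^-1] removes both the translator [h] and the base point [y] of the
   monochromatic corner. *)
have cancel z u : z / (h * y) * (h * (y * u)) = z * u.
  by rewrite (mulgA h) mulgA mulgVK.
move=> /(right_vdW_shift vdW _ (h * y)^-1); congr W.
apply/seteqP; split=> z /= Az => [j jk|_ [j jk <-]].
  by rewrite -cancel; apply: Az; exists j.
by rewrite cancel; exact: Az.
Qed.

Lemma vdW_block_monochromatic a k : block_monochromatic a k.+1.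
Proof.
(* [a] is generalised because the step at [a] uses the hypothesis at [a.+1]. *)
elim: k a => [|k IHk] a; apply: block_recurrent_monochromatic.
  exact: block_recurrent0.
exact/block_monochromatic_recurrent/IHk.
Qed.

End Focusing.

Lemma right_corner_set_IPstar {G : groupType} {m r : nat}
    (chi : {ffun 'I_m -> G} -> 'I_r) (W : set (set {ffun 'I_m -> G})) :
  (0 < m)%N -> right_vdW W -> left_IPstar (right_corner_set chi).
Proof.
case: m chi W => // m chi W _ vdW B [x xB].
(* In [m.+1] components a corner has the points [j <= m.+1], which is the case [a = 0], [k = m]. *)
have [s [[s0 sort_s _] [i [y iy]]]] := vdW_block_monochromatic vdW x 0 m r chi 0.
exists (\prod_(n <- rev s) x n)%g; split; last by apply: xB; exists s.
exists i, y; rewrite right_cornerE => _ [j jm <-] /=.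
by rewrite -[j]add0n; apply: iy.
Qed.

(** * Exchange of left and right by inversion *)

Section Inversion.
Local Open Scope group_scope.
Context {H : groupType}.
Local Notation invg := (@monoid.inv H).
Implicit Types (A S T : set H).

Lemma preimage_invgK : involutive (preimage invg).
Proof. by move=> A; apply/seteqP; split=> y /=; rewrite invgK. Qed.

Lemma preimage_invg_image A : invg @^-1` A = invg @` A.
Proof.
apply/seteqP; split=> [y Ay|_ [y Ay <-]]; last by rewrite /= invgK.
by exists y^-1; rewrite ?invgK.
Qed.

Lemma preimage_invg_rtranslate A x :
  invg @^-1` (rtranslate A x) = ltranslate x^-1 (invg @^-1` A).
Proof.
rewrite rtranslateE ltranslateE; apply/seteqP.
by split=> y /=; rewrite invgM !invgK.
Qed.

Lemma preimage_invg_ltranslate A x :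
  invg @^-1` (ltranslate x A) = rtranslate (invg @^-1` A) x^-1.
Proof.
by rewrite -[A in LHS]preimage_invgK -[in LHS](invgK x)
  -preimage_invg_rtranslate preimage_invgK.
Qed.

Lemma left_syndetic_invg S : left_syndetic S -> right_syndetic (invg @^-1` S).
Proof.
move=> [F [finF synS]]; exists (invg @` F); split; first exact: finite_image.
rewrite bigcup_image -(preimage_setT invg) synS preimage_bigcup.
by apply: eq_bigcupr => h _; rewrite preimage_invg_rtranslate.
Qed.

Lemma right_thick_invg T : right_thick T -> left_thick (invg @^-1` T).
Proof.
move=> thT F finF; have [|x FxT] := thT (invg @` F); first exact: finite_image.
exists x^-1; rewrite -(preimage_invgK (ltranslate _ _)).
apply: preimage_subset.
by rewrite preimage_invg_ltranslate invgK preimage_invg_image.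
Qed.

Lemma left_returns_invg (W : set (set H)) A S : left_returns W A S ->
  right_returns (preimage invg @^-1` W) (invg @^-1` A) (invg @^-1` S).
Proof.
move=> retS F finF [f0 Ff0] FS.
have : W (\bigcap_(f in invg @` F) ltranslate f^-1 A).
  apply: retS; first exact: finite_image.
    by exists f0^-1, f0.
  by move=> _ [f /FS Sf <-].
have <- // : invg @^-1` (\bigcap_(f in F) rtranslate (invg @^-1` A) f^-1) =
    \bigcap_(f in invg @` F) ltranslate f^-1 A.
rewrite bigcap_image preimage_bigcap; apply: eq_bigcapr => f _.
by rewrite preimage_invg_rtranslate preimage_invgK.
Qed.

(** Inversion reverses products, so it exchanges left and right translates, and it commutes with
    unions and intersections. *)
Lemma left_vdW_invg (W : set (set H)) :
  left_vdW W -> right_vdW (preimage invg @^-1` W).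
Proof.
move=> [[[A0 WA0] W0 retW] reg trW]; split.
- split; first by exists (invg @^-1` A0); rewrite /= preimage_invgK.
    by rewrite /= preimage_set0.
  move=> A /retW[] [S [largeS /left_returns_invg]].
    rewrite preimage_invgK => ret; left; exists (invg @^-1` S); split=> //.
    exact: left_syndetic_invg.
  rewrite preimage_invgK => ret; right; exists (invg @^-1` S); split=> //.
  exact: right_thick_invg.
- move=> A WA n B AB; apply: (reg _ WA n (fun i => invg @^-1` B i)).
  by rewrite AB preimage_bigcup.
- by move=> A x /(trW _ x^-1); rewrite -preimage_invg_rtranslate.
Qed.

End Inversion.

Lemma left_corner_set_IPstar {G : groupType} {m r : nat}
    (chi : {ffun 'I_m -> G} -> 'I_r) (W : set (set {ffun 'I_m -> G})) :
  (0 < m)%N -> left_vdW W -> right_IPstar (left_corner_set chi).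
Proof.
move=> m0 vdW B [x xB].
(* Inverting a product reverses its factors: [FP_L] of the inverted sequence consists of the
   inverses of [FP_R x]. *)
have [g [[i [y iy]] [s [s0 sort_s gE]]]] :
    right_corner_set (fun y => chi y^-1%g) `&` FP_L (fun n => (x n)^-1)%g !=set0.
  apply: (right_corner_set_IPstar _ _ m0 (left_vdW_invg _ vdW)).
  by exists (fun n => (x n)^-1)%g.
exists g^-1%g; split; last first.
  by apply: xB; exists s; rewrite gE prodgV revK invgK.
exists i, y^-1%g; rewrite left_cornerE !invgK => _ [z zy <-].
exact: iy.
Qed.

Theorem theorem21 (R : realType) (G : groupType)
    (hcount : countable [set: G]) (hamen : amenable R G)
    (m : nat) (hm : (1 <= m)%N)
    (r : nat) (chi : {ffun 'I_m -> G} -> 'I_r) :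
  (right_vdW_group G -> left_IPstar (right_corner_set chi)) /\
  (left_vdW_group G -> right_IPstar (left_corner_set chi)).
Proof.
split=> /(_ m hm)[W vdW].
- exact: right_corner_set_IPstar _ _ hm vdW.
- exact: left_corner_set_IPstar _ _ hm vdW.
Qed.
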